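(* Let $E$ be a topological field, $G$ a compact topological group, and $\varrho,\varrho'\colon G\to\mathrm{GL}_2(E)$ semisimple continuous representations. If $\varrho$ and $\varrho'$ are locally polyquadratic twists, then they are polyquadratic twists.
   Context: The representations $\varrho,\varrho'$ (of the same degree $r$) are called locally polyquadratic twists if for every $s\in G$ one has $\det(1-\varrho(s^2)T)=\det(1-\varrho'(s^2)T)$. They are called polyquadratic twists if there exist a positive integer $t$, positive integers $n_1,\dots,n_t$, representations $\varrho_i,\varrho_i'\colon G\to\mathrm{GL}_{n_i}(E)$ and quadratic characters $\chi_i$ of $G$ such that $\varrho\simeq\bigoplus_{i=1}^t\varrho_i$, $\varrho'\simeq\bigoplus_{i=1}^t\varrho_i'$ and $\varrho_i'\simeq\chi_i\otimes\varrho_i$ for each $i$. *)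

(* Defs.v *)
From HB Require Import structures.
From mathcomp Require Import all_boot all_order all_algebra.
From mathcomp Require Import all_classical all_reals all_analysis.

Set Implicit Arguments.
Unset Strict Implicit.
Unset Printing Implicit Defensive.

Import GRing.Theory.

Local Open Scope classical_set_scope.
Local Open Scope ring_scope.

(* Neither structure below assumes a separation axiom. *)
HB.mixin Record Group_isTopological G & Group G & Topological G := {
  mulg_continuous : continuous (fun xy : G * G => (xy.1 * xy.2)%g);
  invg_continuous : continuous (fun x : G => (x^-1)%g)
}.

#[short(type="topGroupType")]
HB.structure Definition TopGroup :=
  {G of Group G & Topological G & Group_isTopological G}.

HB.mixin Record Field_isTopological E & GRing.Field E & TopologicalZmodule E := {
  mulf_continuous : continuous (fun xy : E * E => xy.1 * xy.2);
  invf_continuous : forall x : E, x != 0 -> {for x, continuous (fun y : E => y^-1)}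
}.

#[short(type="topFieldType")]
HB.structure Definition TopField :=
  {E of GRing.Field E & TopologicalZmodule E & Field_isTopological E}.

(* A continuous homomorphism G -> GL_n(E), presented as a map to matrices: the
   values are invertible by the two algebraic axioms, and the topology of
   GL_n(E) is the one induced by 'M[E]_n, on which inversion is continuous
   because E is a topological field. *)
Record contRepr (G : topGroupType) (E : topFieldType) (n : nat) := ContRepr {
  repr_mx :> G -> 'M[E]_n;
  repr_mx1 : repr_mx 1%g = 1%:M;
  repr_mxM : forall s u : G, repr_mx (s * u)%g = repr_mx s *m repr_mx u;
  repr_mx_continuous : continuous repr_mx
}.

(* The trivial character counts as quadratic. *)
Record quadChar (G : topGroupType) (E : topFieldType) := QuadChar {
  qchar :> G -> E;
  qcharM : forall s u : G, qchar (s * u)%g = qchar s * qchar u;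
  qchar_pm1 : forall s : G, qchar s = 1 \/ qchar s = -1;
  qchar_continuous : continuous qchar
}.

Section Representations.
Variables (G : topGroupType) (E : topFieldType).

Definition invariant n (rho : contRepr G E n) (U : {vspace 'cV[E]_n}) : Prop :=
  forall (s : G) (v : 'cV[E]_n), v \in U -> rho s *m v \in U.

Definition irreducible_sub n (rho : contRepr G E n) (U : {vspace 'cV[E]_n}) : Prop :=
  [/\ invariant rho U, U != 0%VS &
      forall W : {vspace 'cV[E]_n},
        invariant rho W -> (W <= U)%VS -> W = 0%VS \/ W = U].

Definition semisimple n (rho : contRepr G E n) : Prop :=
  exists (t : nat) (U : 'I_t -> {vspace 'cV[E]_n}),
    [/\ forall i, irreducible_sub rho (U i),
        directv (\sum_(i < t) U i)%VS & (\sum_(i < t) U i)%VS = fullv].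

(* The degrees m and n may be syntactically different; the existence of P and
   of its inverse Q forces m = n. *)
Definition isomorphic m n (rho : G -> 'M[E]_m) (rho' : G -> 'M[E]_n) : Prop :=
  exists (P : 'M[E]_(m, n)) (Q : 'M[E]_(n, m)),
    [/\ P *m Q = 1%:M, Q *m P = 1%:M &
        forall s : G, rho s *m P = P *m rho' s].

Definition direct_sum t (n : 'I_t -> nat) (rho : forall i, contRepr G E (n i)) :
    G -> 'M[E]_(\sum_(i < t) n i) :=
  fun s => \mxdiag_(i < t) rho i s.

Definition twist n (chi : quadChar G E) (rho : contRepr G E n) : G -> 'M[E]_n :=
  fun s => chi s *: rho s.

(* det(1 - A T) in E[T], with T written 'X; not the library's char_poly, which
   is det(T - A). *)
Definition rev_char_poly n (A : 'M[E]_n) : {poly E} :=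
  \det (1%:M - 'X *: map_mx polyC A).

Definition locally_polyquadratic_twists r (rho rho' : contRepr G E r) : Prop :=
  forall s : G,
    rev_char_poly (rho (s ^+ 2)%g) = rev_char_poly (rho' (s ^+ 2)%g).

Definition polyquadratic_twists r (rho rho' : contRepr G E r) : Prop :=
  exists (t : nat) (n : 'I_t -> nat)
         (rho_ rho'_ : forall i, contRepr G E (n i))
         (chi : 'I_t -> quadChar G E),
    [/\ (0 < t)%N,
        forall i, (0 < n i)%N,
        isomorphic rho (direct_sum rho_),
        isomorphic rho' (direct_sum rho'_) &
        forall i, isomorphic (rho'_ i) (twist (chi i) (rho_ i))].

End Representations.

(* Main.v *)
(** Write t, d for the trace and determinant of rho, and t', d' for rho'.  The
    hypothesis says d'^2 = d^2 and t'^2 - 2d' = t^2 - 2d.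

    If rho is a sum of characters l, m and rho' of l', m', then
    {l^2, m^2} = {l'^2, m'^2} at every element; a group is not the union of two proper subgroups, so the same
    matching works everywhere and the quotients of matched characters are
    quadratic.

    Otherwise suppose the characteristic is not 2.  If d' <> d somewhere, put
    H = {d' = d}.  Outside H the discriminant of rho is the square t'^2, and any
    two elements outside H share an eigenline, which forces a common one; so rho
    is reducible, and so is rho' by symmetry.  Hence d' = d and t' = +-t.  The sign
    t'/t is multiplicative on words in elements of nonzero trace, because
    t(xy) + d(y) t(x y^-1) = t(x) t(y); it extends to a quadratic character chi of
    G, which is continuous because it is 1 on {t + t' <> 0}, an open neighbourhood
    of 1 unless E is indiscrete.  Then rho' and the
    twist of rho by chi have the same characteristic polynomials, and are both
    irreducible, hence isomorphic.  In characteristic 2, chi = 1 works. *)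
Require Import Defs.
From mathcomp Require Import all_boot all_order all_algebra.
From mathcomp Require Import all_classical all_reals all_analysis.
From mathcomp Require Import ring.

Set Implicit Arguments.
Unset Strict Implicit.
Unset Printing Implicit Defensive.

Import GRing.Theory.

Local Open Scope classical_set_scope.
Local Open Scope ring_scope.

(** * Two-by-two matrices *)

Lemma lift00 : lift ord0 ord0 = 1 :> 'I_2. Proof. exact: val_inj. Qed.

Lemma det2E (R : comNzRingType) (A : 'M[R]_2) : \det A = A 0 0 * A 1 1 - A 0 1 * A 1 0.
Proof.
rewrite (expand_det_row _ 0) !big_ord_recl big_ord0 lift00 addr0.
rewrite /cofactor !det_mx11 !mxE /= expr0 expr1 mul1r mulN1r mulrN.
by congr (_ * A _ _ - _ * A _ _); apply: val_inj.
Qed.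

Section TwoByTwo.
Context {F : fieldType}.
Implicit Types (A B : 'M[F]_2) (v w : 'cV[F]_2).

Lemma mx2P m (A B : 'M[F]_(2, m)) :
  (forall j, A 0 j = B 0 j) -> (forall j, A 1 j = B 1 j) -> A = B.
Proof.
move=> h0 h1; apply/matrixP=> i j; case: (unliftP ord0 i) => [k ->|->] //.
by rewrite (ord1 k) lift00.
Qed.

Lemma ord2_ind (P : 'I_2 -> Prop) : P 0 -> P 1 -> forall i, P i.
Proof.
move=> h0 h1 i; case: (unliftP ord0 i) => [k ->|->] //.
by rewrite (ord1 k) lift00.
Qed.

Lemma mul2E m n (A : 'M[F]_(m, 2)) (B : 'M[F]_(2, n)) i j :
  (A *m B) i j = A i 0 * B 0 j + A i 1 * B 1 j.
Proof. by rewrite mxE !big_ord_recl big_ord0 lift00 addr0. Qed.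

Lemma tr2E A : \tr A = A 0 0 + A 1 1.
Proof. by rewrite /mxtrace !big_ord_recl big_ord0 lift00 addr0. Qed.

(** Over an algebraic closure this determinant vanishes exactly when [A] and [B] share an eigenline.
    Written in traces and determinants, the condition transfers to any pair with the same
    invariants. *)
Lemma det_commutator A B :
  \det (A *m B - B *m A) =
    4 * \det A * \det B + \tr A * \tr B * \tr (A *m B) - \tr A ^+ 2 * \det B
    - \tr B ^+ 2 * \det A - \tr (A *m B) ^+ 2.
Proof. rewrite !(tr2E, det2E) !(mul2E, mxE); ring. Qed.

Lemma det_add A B :
  \det (A + B) = \det A + \det B + \tr A * \tr B - \tr (A *m B).
Proof. rewrite !(tr2E, det2E) !mul2E !mxE; ring. Qed.

Lemma cayley_hamilton2 A : A *m A = \tr A *: A - (\det A)%:M.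
Proof.
apply: mx2P; apply: ord2_ind;
  rewrite !mxE /= -?[lift _ _]/1 ?mul2E !(tr2E, det2E) !big_ord_recl big_ord0 !lift00 /=; ring.
Qed.

Definition cross v w : F := v 0 0 * w 1 0 - v 1 0 * w 0 0.

Definition eigenvec v A : Prop := exists c, A *m v = c *: v.

Lemma cV2P v w : v 0 0 = w 0 0 -> v 1 0 = w 1 0 -> v = w.
Proof. by move=> h0 h1; apply: mx2P => j; rewrite (ord1 j). Qed.

Lemma cV2_neq0 v : v != 0 -> v 0 0 != 0 \/ v 1 0 != 0.
Proof.
move=> v0; case: (eqVneq (v 0 0) 0) => [h0|]; last by left.
right; apply: contraNneq v0 => h1; apply/eqP/cV2P; by rewrite mxE.
Qed.

Lemma cross_eq0 v w : v != 0 -> cross v w = 0 -> exists c, w = c *: v.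
Proof.
move=> /cV2_neq0[v0|v0] /eqP; rewrite subr_eq0 => /eqP e.
- exists (w 0 0 / v 0 0); apply: cV2P; rewrite mxE; first by field.
  by apply: (mulfI v0); rewrite e; field.
- exists (w 1 0 / v 1 0); apply: cV2P; rewrite mxE; last by field.
  by apply: (mulfI v0); rewrite -e; field.
Qed.

Definition cols v w : 'M[F]_2 := \matrix_(i, j) if j == 0 then v i 0 else w i 0.

Lemma det_cols v w : \det (cols v w) = cross v w.
Proof. by rewrite det2E !mxE /= /cross; ring. Qed.

Definition diag2 (a b : F) : 'M[F]_2 :=
  \matrix_(i, j) if i == j then (if i == 0 then a else b) else 0.

Lemma cross_span v w u : cross v w != 0 -> exists a b, u = a *: v + b *: w.
Proof.
rewrite /cross => h; exists (cross u w / cross v w), (cross v u / cross v w).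
by apply: cV2P; rewrite !mxE /cross; field.
Qed.

Lemma cross_basis v : v != 0 -> exists w, cross v w != 0.
Proof.
move=> /cV2_neq0[h|h].
- by exists (\col_i (i == 1)%:R); rewrite /cross !mxE /= mulr1 mulr0 subr0.
- by exists (\col_i (i == 0)%:R); rewrite /cross !mxE /= mulr1 mulr0 sub0r oppr_eq0.
Qed.

(* The last field says that any two members share an eigenline, possibly only
   over an algebraic closure. *)
Record line_family (T : 'M[F]_2 -> Prop) : Prop := LineFamily {
  lf_det : forall A, T A -> \det A != 0;
  lf_mul3 : forall A B C, T A -> T B -> T C -> T (A *m B *m C);
  lf_eig : forall A, T A -> exists2 v, v != 0 & eigenvec v A;
  lf_comm : forall A B, T A -> T B -> \det (A *m B - B *m A) = 0
}.

Definition common_line (T : 'M[F]_2 -> Prop) : Prop :=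
  exists2 v, v != 0 & forall A, T A -> eigenvec v A.

Lemma eigenvec_e0 A : A 1 0 = 0 -> eigenvec (\col_i (i == 0)%:R) A.
Proof.
move=> h; exists (A 0 0); apply: cV2P; rewrite mul2E !mxE /= ?h; ring.
Qed.

Lemma eigenvec_e1 A : A 0 1 = 0 -> eigenvec (\col_i (i == 1)%:R) A.
Proof.
move=> h; exists (A 1 1); apply: cV2P; rewrite mul2E !mxE /= ?h; ring.
Qed.

Lemma e0_neq0 : (\col_i (i == 0)%:R : 'cV[F]_2) != 0.
Proof. by apply/eqP => /matrixP/(_ 0 0)/eqP; rewrite !mxE /= oner_eq0. Qed.
Lemma e1_neq0 : (\col_i (i == 1)%:R : 'cV[F]_2) != 0.
Proof. by apply/eqP => /matrixP/(_ 1 0)/eqP; rewrite !mxE /= oner_eq0. Qed.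

(** The commutator of [diag2 a b] with [A] has determinant [(a - b)^2 A01 A10], so every member is
    upper or lower triangular. If both kinds occurred strictly, the product upper times lower times
    diagonal would be of neither kind; the diagonal factor is there because only triple products
    stay in [T]. *)
Lemma common_line_diag T a b : line_family T -> T (diag2 a b) -> a != b ->
  common_line T.
Proof.
move=> hT TD ab.
have := lf_det hT TD; rewrite det2E !mxE /= mulr0 subr0 mulf_eq0 negb_or => /andP[a0 b0].
have tri A : T A -> A 0 1 = 0 \/ A 1 0 = 0.
  move=> TA; have := lf_comm hT TD TA.
  rewrite det2E !(mul2E, mxE) /= => e.
  have {e}: (a - b) ^+ 2 * (A 0 1 * A 1 0) = 0 by rewrite -[RHS]e; ring.
  move/eqP; rewrite mulf_eq0 expf_eq0 /= subr_eq0 (negPf ab) /= mulf_eq0.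
  by case/orP => /eqP; [left|right].
case: (pselect (exists2 A, T A & A 1 0 != 0)) => [[B TB B10]|no]; last first.
  exists (\col_i (i == 0)%:R); first exact: e0_neq0.
  move=> A TA; apply: eigenvec_e0; apply/eqP; apply/negPn/negP => h.
  by apply: no; exists A.
exists (\col_i (i == 1)%:R); first exact: e1_neq0.
move=> A TA; apply: eigenvec_e1; apply/eqP; apply/negPn/negP => A01.
have [B01|/eqP] := tri B TB; last by rewrite (negPf B10).
have [/eqP|A10] := tri A TA; first by rewrite (negPf A01).
have := lf_det hT TB; rewrite det2E B01 mul0r subr0 mulf_eq0 negb_or => /andP[B00 B11].
have := lf_det hT TA; rewrite det2E A10 mulr0 subr0 mulf_eq0 negb_or => /andP[A00 A11].
have [|] := tri _ (lf_mul3 hT TA TB TD); rewrite !mul2E !mxE /= ?B01 ?A10 => /eqP.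
- by rewrite !(mulr0, mul0r, addr0, add0r) !mulf_eq0 (negPf A01) (negPf B11) (negPf b0).
- by rewrite !(mulr0, mul0r, addr0, add0r) !mulf_eq0 (negPf A11) (negPf B10) (negPf a0).
Qed.

Definition jordan2 (a y : F) : 'M[F]_2 :=
  \matrix_(i, j) if i == j then a else if i == 0 then y else 0.

Lemma common_line_jordan T a y : line_family T -> T (jordan2 a y) -> y != 0 ->
  common_line T.
Proof.
move=> hT TD y0; exists (\col_i (i == 0)%:R); first exact: e0_neq0.
move=> A TA; apply: eigenvec_e0; have := lf_comm hT TD TA.
rewrite det2E !(mul2E, mxE) /= => e.
have {e}: (y * A 1 0) ^+ 2 = 0 by rewrite -[RHS]oppr0 -e; ring.
by move/eqP; rewrite expf_eq0 /= mulf_eq0 (negPf y0) /= => /eqP.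
Qed.

Lemma line_family_conj T P : P \in unitmx -> line_family T ->
  line_family (fun B => T (P *m B *m invmx P)).
Proof.
move=> uP hT; split=> [A|A B C|A|A B].
- by move/(lf_det hT); rewrite !det_mulmx mulrAC det_inv mulrV ?mul1r // -unitmxE.
- move=> hA hB hC; have := lf_mul3 hT hA hB hC.
  by rewrite !mulmxA !(mulmxKV uP).
- move=> /(lf_eig hT)[v v0 [c e]]; exists (invmx P *m v).
    by apply: contraNneq v0 => e0; rewrite -(mulKVmx uP v) e0 mulmx0.
  by exists c; rewrite scalemxAr -e !mulmxA mulVmx // mul1mx.
- move=> hA hB; have := lf_comm hT hA hB.
  rewrite !mulmxA !(mulmxKV uP) -mulmxBl -!mulmxA -mulmxBr !det_mulmx.
  by rewrite mulrAC det_inv mulrV ?mul1r // -unitmxE.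
Qed.

Lemma common_line_conj T P : P \in unitmx ->
  common_line (fun B => T (P *m B *m invmx P)) -> common_line T.
Proof.
move=> uP [v v0 h]; exists (P *m v).
  by apply: contraNneq v0 => e0; rewrite -(mulKmx uP v) e0 mulmx0.
move=> A TA; have [|c e] := h (invmx P *m A *m P).
  by rewrite !mulmxA mulmxK // mulmxV // mul1mx.
by exists c; rewrite scalemxAr -e !mulmxA mulmxV // mul1mx.
Qed.

Lemma mul_cols A v w : A *m cols v w = cols (A *m v) (A *m w).
Proof. by apply/matrixP=> i j; rewrite !(mul2E, mxE); case: ifP. Qed.

Lemma cols_unit v w : (cols v w \in unitmx) = (cross v w != 0).
Proof. by rewrite unitmxE det_cols unitfE. Qed.

Lemma cols_diag v w a b : cols v w *m diag2 a b = cols (a *: v) (b *: w).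
Proof.
by apply/matrixP=> i; apply: ord2_ind; rewrite !(mul2E, mxE) /=; ring.
Qed.

Lemma cols_jordan v w a y : cols v w *m jordan2 a y = cols (a *: v) (y *: v + a *: w).
Proof.
by apply/matrixP=> i; apply: ord2_ind; rewrite !(mul2E, mxE) /=; ring.
Qed.

(** A nonscalar member is triangular in a basis that starts with one of its eigenvectors. Its two
    eigenvalues decide whether it is conjugate to a Jordan block or to a diagonal matrix, the two
    cases already settled. *)
Lemma line_family_common T : line_family T -> common_line T.
Proof.
move=> hT.
case: (pselect (forall A, T A -> exists c, A = c%:M)) => [sc|].
  exists (\col_i (i == 0)%:R); first exact: e0_neq0.
  by move=> A /sc[c ->]; exists c; rewrite mul_scalar_mx.
move=> /existsNP[A /not_implyP[TA nsc]].
have [v v0 [a ea]] := lf_eig hT TA.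
have [w cvw] := cross_basis v0.
have [y [b eb]] := cross_span (A *m w) cvw.
have red P D : P \in unitmx -> A *m P = P *m D ->
   (line_family (fun B => T (P *m B *m invmx P)) -> T (P *m D *m invmx P) -> 
     common_line (fun B => T (P *m B *m invmx P))) -> common_line T.
  move=> uP e h; apply: (common_line_conj uP); apply: h; first exact: line_family_conj.
  by rewrite -e mulmxK.
case: (eqVneq a b) => [ab|ab].
- have y0 : y != 0.
    apply/eqP => y0; apply: nsc; exists a.
    have uP : cols v w \in unitmx by rewrite cols_unit.
    apply: (can_inj (mulmxK uP)); rewrite mul_scalar_mx mul_cols ea eb y0 scale0r add0r ab.
    by apply/matrixP=> i j; rewrite !mxE; case: ifP.
  apply: (red (cols v w) (jordan2 a y)); rewrite ?cols_unit //.
    by rewrite mul_cols cols_jordan ea eb ab.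
  by move=> h1 h2; apply: (common_line_jordan h1 h2).
(* The multiple of [v] is chosen to make [w'] an eigenvector for [b]. *)
- pose w' := w + (y / (b - a)) *: v.
  have ba : b - a != 0 by rewrite subr_eq0 eq_sym.
  apply: (red (cols v w') (diag2 a b)).
  + rewrite cols_unit; move: cvw; rewrite /cross !mxE; congr (_ != 0); ring.
  + rewrite mul_cols cols_diag ea mulmxDr eb -scalemxAr ea; congr cols.
    by apply: cV2P; rewrite !mxE; field.
  + by move=> h1 h2; apply: (common_line_diag h1 h2).
Qed.

End TwoByTwo.

(** * Trace and determinant identities along a group *)

Section Reprs.
Context {F : fieldType} {G : groupType}.
Implicit Types (R : G -> 'M[F]_2) (x y g h : G).

Definition mx_hom R := R 1%g = 1%:M /\ forall x y, R (x * y)%g = R x *m R y.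

Variable (R : G -> 'M[F]_2).
Hypothesis hR : mx_hom R.
Local Notation t x := (\tr (R x)).
Local Notation d x := (\det (R x)).

Lemma homM x y : R (x * y)%g = R x *m R y. Proof. by case: hR. Qed.
Lemma hom1 : R 1%g = 1%:M. Proof. by case: hR. Qed.
Lemma homVr x : R x *m R x^-1%g = 1%:M. Proof. by rewrite -homM mulgV hom1. Qed.

Lemma det_homM x y : d (x * y)%g = d x * d y.
Proof. by rewrite homM det_mulmx. Qed.
Lemma det_neq0 x : d x != 0.
Proof.
have : d x * d x^-1%g = 1 by rewrite -det_homM mulgV hom1 det1.
by move=> e; apply/eqP => e0; move/eqP: e; rewrite e0 mul0r eq_sym oner_eq0.
Qed.
Lemma tr_hom1 : t 1%g = 2.
Proof. by rewrite hom1 tr2E !mxE /=; ring. Qed.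
(** Cayley-Hamilton multiplied by the inverse; both sides are the adjugate of [R x]. *)
Lemma hom_adj x : d x *: R x^-1%g = (t x)%:M - R x.
Proof.
have := congr1 (mulmx^~ (R x^-1%g)) (cayley_hamilton2 (R x)).
rewrite /= mulmxBl -mulmxA homVr mulmx1 -scalemxAl homVr mul_scalar_mx scalemx1 => e.
by apply: (addIr (R x)); rewrite subrK [X in _ + X = _]e addrC subrK.
Qed.

(** Replace [R y] by [t y - d y R(y^-1)] in the middle of the product. This is the device for
    shortening words. *)
Lemma tr_merge x y g :
  t (x * (y * g))%g = t y * t (x * g)%g - d y * t (x * y^-1 * g)%g.
Proof.
have e : R y = (t y)%:M - d y *: R y^-1%g by rewrite hom_adj opprB addrC subrK.
rewrite !homM {1}e mulmxBl mulmxBr mul_scalar_mx -!scalemxAl -!scalemxAr mulmxA.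
by rewrite raddfB /= !linearZ.
Qed.

Lemma trM x y : t (x * y)%g + d y * t (x * y^-1)%g = t x * t y.
Proof. have := tr_merge x y 1%g; rewrite !mulg1 => ->; ring. Qed.

Lemma trV x : d x * t x^-1%g = t x.
Proof. have := trM 1%g x; rewrite !mul1g tr_hom1 => e; apply: (addrI (t x)); rewrite e; ring. Qed.

Lemma tr_sqr x : t (x * x)%g = t x ^+ 2 - 2 * d x.
Proof. have := trM x x; rewrite mulgV tr_hom1 => e; rewrite expr2 -e; ring. Qed.

Lemma det_comm x y : \det (R x *m R y - R y *m R x) = 
  4 * d x * d y + t x * t y * t (x * y)%g - t x ^+ 2 * d y - t y ^+ 2 * d x - t (x * y)%g ^+ 2.
Proof. by rewrite det_commutator -homM. Qed.

End Reprs.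

(** * Extending the sign of the trace ratio *)

(** Only opposite signs need an argument: then [(a - b)^2 = (a + b)^2] forces [a b = 0], and both
    sides equal [a' a]. *)
Lemma sign_sum (F : fieldType) (a b s a' b' s' : F) : 2 != 0 :> F ->
  a + b = s -> a' + b' = s' -> a' ^+ 2 = a ^+ 2 -> b' ^+ 2 = b ^+ 2 ->
  s' ^+ 2 = s ^+ 2 -> a' * s = a * s'.
Proof.
move=> two0 <- <- /eqP ea /eqP eb e.
have ab0 : (a - b) ^+ 2 = (a + b) ^+ 2 -> a * b = 0.
  move=> {}e; have /eqP : 2 ^+ 2 * (a * b) = 0.
    by rewrite -[RHS](subrr ((a - b) ^+ 2)) {1}e; ring.
  by rewrite mulf_eq0 expf_eq0 /= (negPf two0) /= => /eqP.
move: ea eb e; rewrite !eqf_sqr => /orP[] /eqP-> /orP[] /eqP-> e; try by ring.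
- by rewrite mulrDr mulrDr mulrN ab0 //; ring.
- have e0 : a * b = 0 by apply: ab0; rewrite -e; ring.
  by rewrite !(mulrDr, mulrDl, mulrN, mulNr) e0; ring.
Qed.

Lemma det_sub_scalar (F : fieldType) (A : 'M[F]_2) c :
  \det (A - c%:M) = \det A - \tr A * c + c ^+ 2.
Proof. by rewrite !(tr2E, det2E) !mxE /=; ring. Qed.

Lemma det0_vec (F : fieldType) (A : 'M[F]_2) : \det A = 0 ->
  exists2 v : 'cV[F]_2, v != 0 & A *m v = 0.
Proof.
rewrite -det_tr => /eqP/det0P[v v0 e]; exists v^T.
  by apply: contraNneq v0 => e0; rewrite -[v]trmxK e0 trmx0.
by rewrite -[X in X *m _]trmxK -trmx_mul e trmx0.
Qed.

Lemma eigenvec_of_root (F : fieldType) (A : 'M[F]_2) c :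
  \det A - \tr A * c + c ^+ 2 = 0 -> exists2 v, v != 0 & eigenvec v A.
Proof.
rewrite -det_sub_scalar => /det0_vec[v v0 e]; exists v => //.
by exists c; apply/eqP; rewrite -subr_eq0 -mul_scalar_mx -mulmxBl e.
Qed.

(** Polarised Cayley-Hamilton. *)
Lemma anticommutator2 (F : fieldType) (A B : 'M[F]_2) :
  A *m B + B *m A = \tr A *: B + \tr B *: A + (\tr (A *m B) - \tr A * \tr B)%:M.
Proof.
apply: mx2P; apply: ord2_ind; rewrite !(tr2E, mul2E, mxE) /=; ring.
Qed.

(** * Sign characters on subgroups containing all squares *)

Section PartialCharacters.
Context {F : fieldType} {G : groupType}.
Implicit Types (K : G -> F -> Prop) (x y g : G) (a b : F).

(** The graph of a character of a subgroup that contains all squares and on which they have value 1.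
    A relation is used because values first arise from words, before they are known to be well
    defined; [pc1] is what gives single-valuedness. *)
Record partial_char K : Prop := PartialChar {
  pcM : forall x y a b, K x a -> K y b -> K (x * y)%g (a * b);
  pc1 : forall a, K 1%g a -> a = 1;
  pc_sqr : forall x, K (x * x)%g 1
}.

Section Theory.
Variable K : G -> F -> Prop.
Hypothesis hK : partial_char K.

Lemma pcM1 x y a : K x 1 -> K y a -> K (x * y)%g a.
Proof. by move=> h1 h2; rewrite -[a]mul1r; apply: pcM. Qed.

(** The product of [x^-2], [x] and [x] is the identity and carries the value [1 a b]. *)
Lemma pc_mul_eq1 x a b : K x a -> K x b -> a * b = 1.
Proof.
move=> ha hb; apply: (pc1 hK).
have := pcM1 (pc_sqr hK x^-1%g) (pcM hK ha hb).
by rewrite mulgA mulgVK mulVg.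
Qed.

Lemma pc_pm1 x a : K x a -> a = 1 \/ a = -1.
Proof.
move=> h; have /eqP := pc_mul_eq1 h h.
by rewrite -expr2 sqrf_eq1 => /orP[] /eqP; [left|right].
Qed.

Lemma pc_fun x a b : K x a -> K x b -> a = b.
Proof.
move=> ha hb; have ab := pc_mul_eq1 ha hb; have bb := pc_mul_eq1 hb hb.
by rewrite -[a]mulr1 -bb mulrA ab mul1r.
Qed.

Lemma pcV x a : K x a -> K x^-1%g a.
Proof. by move=> h; have := pcM1 (pc_sqr hK x^-1%g) h; rewrite mulgVK. Qed.

Lemma pcJ x g a : K x a -> K (g^-1 * x * g)%g a.
Proof.
move=> h; have hc := pcM1 (pc_sqr hK (x * g^-1)%g) (pc_sqr hK g).
(* The conjugate is [x] times the squares of [x^-1], [x g^-1] and [g], in this order. *)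
have := pcM hK h (pcM1 (pc_sqr hK x^-1%g) hc); rewrite mulr1.
by congr (K _ _); rewrite !mulgA mulgV mul1g mulVg mul1g mulgVK.
Qed.

(* Commutators are products of squares, so the values of K are invariant under
   conjugation, and K may be set to 1 at a new element g. *)
Lemma pc_extend g : exists K', [/\ partial_char K', forall x a, K x a -> K' x a &
  exists a, K' g a].
Proof.
case: (pselect (exists a, K g a)) => [hg|ng]; first by exists K.
(* If [H] is the domain of [K], the new domain is the union of [H] and the coset [g H], and [g h]
   gets the value of [h]. *)
exists (fun x a => K x a \/ K (g^-1 * x)%g a); split; last first.
- by exists 1; right; have := pc_sqr hK 1%g; rewrite mulg1 mulVg.
- by left.
split=> [x y a b [hx|hx] [hy|hy]|a|x]; first by left; apply: pcM.
- right; rewrite (_ : (g^-1 * (x * y) = (g^-1 * x * g) * (g^-1 * y))%g).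
    by apply: pcM => //; apply: pcJ.
  by rewrite !mulgA mulgK.
- by right; rewrite mulgA; apply: pcM.
- left; rewrite (_ : (x * y = g * g * ((g^-1 * (g^-1 * x) * g) * (g^-1 * y)))%g).
    by apply: pcM1; [apply: pc_sqr|apply: pcM => //; apply: pcJ].
  by rewrite !mulgA mulgK mulgK mulgV mul1g.
- case=> [|h]; first exact: pc1.
  (* The identity cannot lie in [g H], since [g] was outside [H]. *)
  by case: ng; exists a; rewrite mulg1 in h; rewrite -[g]invgK; apply: pcV.
- by left; apply: pc_sqr.
Qed.

End Theory.
End PartialCharacters.

(** * Signs of traces for two homomorphisms with equal determinants *)

Section SameDeterminant.
Context {F : fieldType} {G : groupType}.
Variables R S : G -> 'M[F]_2.
Hypotheses (hR : mx_hom R) (hS : mx_hom S) (two0 : 2 != 0 :> F).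

(** Compare [trM] for [R] and [S] by [sign_sum]. The hypotheses are pointwise because the index-two
    argument below has them only on a subgroup. *)
Lemma tr_sign_mul x y : \det (S y) = \det (R y) ->
    \tr (S (x * y)%g) ^+ 2 = \tr (R (x * y)%g) ^+ 2 ->
    \tr (S (x * y^-1)%g) ^+ 2 = \tr (R (x * y^-1)%g) ^+ 2 ->
    (\tr (S x) * \tr (S y)) ^+ 2 = (\tr (R x) * \tr (R y)) ^+ 2 ->
  \tr (S (x * y)%g) * (\tr (R x) * \tr (R y)) =
  \tr (R (x * y)%g) * (\tr (S x) * \tr (S y)).
Proof.
move=> ed e1 e2 e3.
have hr := trM hR x y; have hs := trM hS x y; rewrite ed in hs.
by apply: (sign_sum two0 hr hs) => //; rewrite !exprMn e2.
Qed.

Hypotheses (eqd : forall x, \det (S x) = \det (R x))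
  (eqt : forall x, \tr (S x) ^+ 2 = \tr (R x) ^+ 2).

Local Notation t x := (\tr (R x)).
Local Notation t' x := (\tr (S x)).

(** Words in letters of nonzero trace, with the product of the signs of their letters; one element
    may a priori carry several values. *)
Inductive signed_word : G -> F -> Prop :=
| SignedNil : signed_word 1%g 1
| SignedCons x g a : t x != 0 -> signed_word g a ->
    signed_word (x * g)%g (t' x / t x * a).

Lemma signed_word_gen x : t x != 0 -> signed_word x (t' x / t x).
Proof. by move=> h; have := SignedCons h SignedNil; rewrite mulg1 mulr1. Qed.

Lemma tr0S x : t x = 0 -> t' x = 0.
Proof. by move=> h; have /eqP := eqt x; rewrite h expr0n /= expf_eq0 => /eqP. Qed.

(* When t(xy) = 0 the letters x, y cannot be merged, but then x y^-1 has nonzero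
   trace and t(xyg) = t(y) t(xg) - d(y) t(x y^-1 g) has one letter less in each
   term. *)
Lemma signed_word_trM g a : signed_word g a -> forall x, t x != 0 ->
  t' (x * g)%g = t' x / t x * a * t (x * g)%g.
Proof.
elim=> {g a} [|y g a ty _ IH] x tx; first by rewrite mulg1 mulr1 divfK.
have [txy|txy] := eqVneq (t (x * y)%g) 0; last first.
  rewrite mulgA IH //.
  have := @tr_sign_mul x y (eqd y) (eqt _) (eqt _).
  rewrite !exprMn !eqt => /(_ erefl) e.
  have -> : t' (x * y)%g = t (x * y)%g * (t' x * t' y) / (t x * t y).
    by rewrite -e; field; rewrite tx ty.
  by field; rewrite tx ty txy.
have hr := trM hR x y; have hs := trM hS x y.
rewrite txy add0r in hr; rewrite (tr0S txy) add0r eqd in hs.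
have dy := det_neq0 hR y.
have txy' : t (x * y^-1)%g != 0.
  apply/eqP => h; move: hr; rewrite h mulr0 => /esym/eqP.
  by rewrite mulf_eq0 (negPf tx) (negPf ty).
rewrite (tr_merge hS) (tr_merge hR) IH // IH // eqd.
have -> : t' (x * y^-1)%g = t' x * t' y / \det (R y) by rewrite -hs; field.
have e : t (x * y^-1)%g = t x * t y / \det (R y) by rewrite -hr; field.
by rewrite e; field; rewrite tx ty dy.
Qed.

(** Prepend the identity as a letter: its trace 2 is nonzero and its sign is 1. *)
Lemma signed_word_tr g a : signed_word g a -> t' g = a * t g.
Proof.
move=> h; have t1 : t 1%g != 0 by rewrite (tr_hom1 hR).
have := signed_word_trM h t1; rewrite mul1g => ->.
by rewrite (tr_hom1 hS) (tr_hom1 hR) divff // mul1r.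
Qed.

Lemma signed_word_partial_char : partial_char signed_word.
Proof.
split=> [x y a b|a /signed_word_tr|x].
- move=> hx hy; elim: hx => {x a} [|x g a tx _ IH]; first by rewrite mul1g mul1r.
  by rewrite -mulgA -mulrA; apply: SignedCons.
- rewrite (tr_hom1 hS) (tr_hom1 hR) => h; apply: (mulIf two0); by rewrite mul1r -h.
(* If [x^2] has nonzero trace it is a letter of sign 1. Otherwise [t(x)^2 = 2 d(x)] is nonzero, and
   [x^2] is the two-letter word [x x], whose sign is a square of a sign. *)
- have e : t' (x * x)%g = t (x * x)%g by rewrite !tr_sqr // eqd eqt.
  case: (eqVneq (t (x * x)%g) 0) => h; last first.
    by have := signed_word_gen h; rewrite e divff.
  have tx : t x != 0.
    apply/eqP => tx; move/eqP: h; rewrite tr_sqr // tx expr0n /= sub0r oppr_eq0.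
    by rewrite mulf_eq0 (negPf two0) (negPf (det_neq0 hR x)).
  have := SignedCons tx (signed_word_gen tx).
  by rewrite mulrACA -invfM -!expr2 eqt divff // expf_neq0.
Qed.

(* Two extensions suffice: elements g0, g1, g2 still missed successively would
   have, with all their products, trace 0, hence anticommute pairwise, and g2
   would both commute and anticommute with g0 g1. *)
Lemma tr_sign_char : exists chi : G -> F,
  [/\ forall x y, chi (x * y)%g = chi x * chi y,
      forall x, chi x = 1 \/ chi x = -1,
      forall x, t' x = chi x * t x &
      forall x, t' x = t x -> t x != 0 -> chi x = 1].
Proof.
suff [K [hK sK totK]] : exists K, [/\ partial_char K,
    forall x a, signed_word x a -> K x a & forall x, exists a, K x a].
  pose chi x := projT1 (cid (totK x)).
  have hchi x : K x (chi x) := projT2 (cid (totK x)).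
  exists chi; split=> [x y|x|x|x e tx].
  - by apply: (pc_fun hK (hchi _)); apply: pcM.
  - exact: (pc_pm1 hK (hchi x)).
  - case: (eqVneq (t x) 0) => tx; first by rewrite (tr0S tx) tx mulr0.
    rewrite (pc_fun hK (hchi x) (sK _ _ (signed_word_gen tx))); by rewrite divfK.
  - by rewrite (pc_fun hK (hchi x) (sK _ _ (signed_word_gen tx))) e divff.
have [/existsNP[g0 n0]|tot] := pselect (~ forall x, exists a, signed_word x a); last first.
  exists signed_word; split=> //; first exact: signed_word_partial_char.
  exact: contrapT tot.
have [K1 [hK1 s1 d0]] := pc_extend signed_word_partial_char g0.
have [/existsNP[g1 n1]|tot] := pselect (~ forall x, exists a, K1 x a); last first.
  by exists K1; split=> //; exact: contrapT tot.
have [K2 [hK2 s2 d1]] := pc_extend hK1 g1.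
exists K2; split=> // [x a /s1/s2//|g2]; apply: contrapT => n2.
have {}d0' : exists a, K2 g0 a by case: d0 => a /s2; exists a.
(* Elements of nonzero trace are one-letter words, so an element that is missed has trace 0. *)
have tr0 K x : (forall y a, signed_word y a -> K y a) -> ~ (exists a, K x a) -> t x = 0.
  move=> sK nx; apply/eqP/negPn/negP => tx; apply: nx.
  by exists (t' x / t x); apply/sK/signed_word_gen.
have out (K : G -> F -> Prop) x y : partial_char K -> (exists a, K x a) -> ~ (exists a, K y a) ->
    ~ (exists a, K (x * y)%g a).
  move=> hK [a ha] ny [b hb]; apply: ny; exists (a * b).
  by have := pcM hK (pcV hK ha) hb; rewrite mulKg.
have s2' x a : signed_word x a -> K2 x a by move/s1/s2.
have t0 := tr0 _ _ (fun _ _ => id) n0.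
have t1 := tr0 _ _ s1 n1.
have t2 := tr0 _ _ s2' n2.
have t01 := tr0 _ _ s1 (out _ _ _ hK1 d0 n1).
have t02 := tr0 _ _ s2' (out _ _ _ hK2 d0' n2).
have n12 := out _ _ _ hK2 d1 n2.
have t12 := tr0 _ _ s2' n12.
have t012 := tr0 _ _ s2' (out _ _ _ hK2 d0' n12).
have anti x y : t x = 0 -> t y = 0 -> t (x * y)%g = 0 -> R (x * y)%g = - R (y * x)%g.
  move=> ex ey exy; apply/eqP; rewrite -addr_eq0 !homM // anticommutator2 -homM //.
  by rewrite ex ey exy mulr0 subrr !scale0r !add0r raddf0 eqxx.
have e1 : R (g0 * (g1 * g2))%g = - R (g2 * (g0 * g1))%g.
  by rewrite [in LHS]mulgA; apply: anti => //; rewrite -mulgA.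
have e2 : R (g0 * (g1 * g2))%g = R (g2 * (g0 * g1))%g.
  rewrite [LHS](homM hR) (anti _ _ t1 t2 t12) (homM hR g2 g1) mulmxN mulmxA -(homM hR).
  by rewrite (anti _ _ t0 t2 t02) mulNmx opprK -(homM hR) mulgA.
have := det_neq0 hR (g2 * (g0 * g1))%g.
have : 2 *: R (g2 * (g0 * g1))%g = 0.
  by rewrite scaler_nat mulr2n -{1}e2 e1 addNr.
by move/eqP; rewrite scaler_eq0 (negPf two0) /= => /eqP->; rewrite det0 eqxx.
Qed.

End SameDeterminant.

(** * Reducibility and isomorphism *)

Section Reducibility.
Context {F : fieldType} {G : groupType}.
Implicit Types (R S : G -> 'M[F]_2) (x y g h : G).

Definition reducible R := common_line (fun A => exists x, A = R x).

Definition diagonalized R (P : 'M[F]_2) (l m : G -> F) :=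
  P \in unitmx /\ forall x, R x *m P = P *m diag2 (l x) (m x).

Lemma diagonalizedE R P l m : diagonalized R P l m ->
  forall x, R x = P *m diag2 (l x) (m x) *m invmx P.
Proof. by case=> uP h x; rewrite -h mulmxK. Qed.

Lemma diagonalized_tr R P l m : diagonalized R P l m -> forall x, \tr (R x) = l x + m x.
Proof.
move=> h x; rewrite (diagonalizedE h) mxtrace_mulC mulmxA mulVmx ?mul1mx; last by case: h.
by rewrite tr2E !mxE.
Qed.

Lemma diagonalized_det R P l m : diagonalized R P l m -> forall x, \det (R x) = l x * m x.
Proof.
move=> h x; have [uP _] := h; rewrite (diagonalizedE h) !det_mulmx mulrAC det_inv.
by rewrite mulrV ?mul1r -?unitmxE // det2E !mxE /= mulr0 subr0.
Qed.

Lemma diagonalized_comm R P l m : diagonalized R P l m -> forall x y,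
  R x *m R y = R y *m R x.
Proof.
move=> h x y; have [uP _] := h; rewrite !(diagonalizedE h) !mulmxA !(mulmxKV uP).
congr (_ *m _); rewrite -!mulmxA; congr (_ *m _).
by apply: mx2P; apply: ord2_ind; rewrite !mul2E !mxE /=; ring.
Qed.

Lemma diagonalized_hom R P l m : mx_hom R -> diagonalized R P l m ->
  (forall x y, l (x * y)%g = l x * l y) /\ (forall x y, m (x * y)%g = m x * m y).
Proof.
move=> hR h; have [uP _] := h.
have e x y : diag2 (l (x * y)%g) (m (x * y)%g) = diag2 (l x) (m x) *m diag2 (l y) (m y).
  have uV : invmx P \in unitmx by rewrite unitmx_inv.
  apply: (can_inj (mulKmx uP)); apply: (can_inj (mulmxK uV)).
  by rewrite mulmxA -(diagonalizedE h) homM // !(diagonalizedE h) !mulmxA !(mulmxKV uP).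
split=> x y; have := e x y => /matrixP.
- by move=> /(_ 0 0); rewrite mul2E !mxE /= mulr0 addr0.
- by move=> /(_ 1 1); rewrite mul2E !mxE /= mulr0 add0r.
Qed.

(** The determinants of commutators depend only on traces and determinants, so they vanish for [S]
    as they do for the commuting values of [R]; the root [l x] provides eigenvectors over [F]
    itself. *)
Lemma diagonalized_reducible R S P l m : mx_hom R -> mx_hom S ->
  diagonalized R P l m -> (forall x, \tr (S x) = \tr (R x)) ->
  (forall x, \det (S x) = \det (R x)) -> reducible S.
Proof.
move=> hR hS h et ed; apply: line_family_common; split.
- by move=> _ [x ->]; exact: det_neq0.
- by move=> _ _ _ [x ->] [y ->] [z ->]; exists (x * y * z)%g; rewrite !homM.
- move=> _ [x ->]; apply: (@eigenvec_of_root _ _ (l x)).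
  by rewrite et ed (diagonalized_tr h) (diagonalized_det h); ring.
- move=> _ _ [x ->] [y ->]; rewrite det_comm // !et !ed -det_comm //.
  by rewrite (diagonalized_comm h) subrr det0.
Qed.

(* If g, h outside H = {det S = det R} share no eigenline, then tr (h^2) and
   tr (g^2) vanish; applying this to the pair h, g h^2 as well gives a contradiction. *)
Lemma index2_reducible R S : mx_hom R -> mx_hom S -> 2 != 0 :> F ->
  (forall x, \det (S x) = \det (R x) \/ \det (S x) = - \det (R x)) ->
  (forall x, \tr (S x) ^+ 2 - 2 * \det (S x) = \tr (R x) ^+ 2 - 2 * \det (R x)) ->
  (exists x, \det (S x) != \det (R x)) -> reducible R.
Proof.
move=> hR hS two0 eps et [g0 hg0].
pose off x := \det (S x) != \det (R x).
have on_tr x : ~~ off x -> \tr (S x) ^+ 2 = \tr (R x) ^+ 2.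
  by move/negPn/eqP => e; have := et x; rewrite e => /addIr.
have off_det x : off x -> \det (S x) = - \det (R x).
  by move=> ox; have [/eqP|] := eps x; first by rewrite (negPf ox).
have off_tr x : off x -> \tr (S x) ^+ 2 = \tr (R x) ^+ 2 - 4 * \det (R x).
  move/off_det => e; have := et x; rewrite e => h.
  have -> : \tr (S x) ^+ 2 = (\tr (S x) ^+ 2 - 2 * - \det (R x)) - 2 * \det (R x) by ring.
  by rewrite h; ring.
have detV T x : mx_hom T -> \det (T x^-1%g) = (\det (T x))^-1.
  move=> hT; apply: (mulfI (det_neq0 hT x)); rewrite -det_homM // mulgV hom1 // det1.
  by rewrite divff // det_neq0.
have offV x : off x -> off x^-1%g.
  by apply: contra_neq; rewrite !detV // => /invr_inj.
have off2 x y : off x -> off y -> ~~ off (x * y)%g.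
  move=> /off_det ex /off_det ey.
  by apply/negPn/eqP; rewrite !det_homM // ex ey mulrNN.
have on_off x y : ~~ off x -> off y -> off (x * y)%g.
  move=> /negPn/eqP ex oy; rewrite /off !det_homM // ex.
  by apply: contra_neq oy; apply: mulfI; apply: det_neq0.
have off_on x y : off x -> ~~ off y -> off (x * y)%g.
  move=> oy /negPn/eqP ex; rewrite /off !det_homM // ex.
  by apply: contra_neq oy; apply: mulIf; apply: det_neq0.
(* Here [a' = +-a] and [b' = +-b], and four times the commutator determinant is
   [(a' - b')^2 - (a - b)^2]. Being nonzero, it forces [a' b' = - a b] with [a b] nonzero. *)
have bad g h : off g -> off h -> \det (R g *m R h - R h *m R g) != 0 ->
    \tr (R h) ^+ 2 = 2 * \det (R h).
  move=> og oh nc; set a := \tr (R (g * h)%g); pose b := \det (R h) * \tr (R (g * h^-1)%g).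
  set a' := \tr (S (g * h)%g); pose b' := \det (R h) * \tr (S (g * h^-1)%g).
  have hr : a + b = \tr (R g) * \tr (R h) by apply: trM.
  have hs : a' - b' = \tr (S g) * \tr (S h).
    by have := trM hS g h; rewrite (off_det h oh) mulNr.
  have ongh := off2 _ _ og oh; have ongh' := off2 _ _ og (offV _ oh).
  have ea : a' ^+ 2 = a ^+ 2 by apply: on_tr.
  have eb : b' ^+ 2 = b ^+ 2 by rewrite !exprMn on_tr.
  have nab : (a' - b') ^+ 2 != (a - b) ^+ 2.
    apply: contra_neq nc => e.
    have e4 : 2 ^+ 2 * \det (R g *m R h - R h *m R g)
        = (a' - b') ^+ 2 - (2 * a - \tr (R g) * \tr (R h)) ^+ 2.
      by rewrite hs exprMn !off_tr // det_comm // -/a; ring.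
    have {e4} : 2 ^+ 2 * \det (R g *m R h - R h *m R g) = 0.
      by rewrite e4 e -hr; ring.
    by move/eqP; rewrite mulf_eq0 expf_eq0 /= (negPf two0) /= => /eqP.
  have [ab' ab0] : a' * b' = - (a * b) /\ a * b != 0.
    move: ea eb => /eqP + /eqP; rewrite !eqf_sqr => ea eb.
    split.
      case/orP: ea => /eqP ea; case/orP: eb => /eqP eb; rewrite ea eb ?mulNr ?mulrN //;
        case/eqP: nab; rewrite ea eb; ring.
    apply: contra_neq nab => /eqP; rewrite mulf_eq0 => /orP[] /eqP e0.
    - move: ea; rewrite e0 oppr0 orbb => /eqP->.
      by rewrite !sub0r !sqrrN; apply/eqP; rewrite eqf_sqr.
    - move: eb; rewrite e0 oppr0 orbb => /eqP->.
      by rewrite subr0 addr0; apply/eqP; rewrite eqf_sqr.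
  have ehg T : mx_hom T -> \det (T (g * h^-1)%g) * \tr (T (h * g^-1)%g) = \tr (T (g * h^-1)%g).
    by move=> hT; have := trV hT (g * h^-1)%g; rewrite invgM invgK.
  have eu : \det (S (g * h^-1)%g) = \det (R (g * h^-1)%g) by apply/eqP/negPn.
  (* Both factors of [h^2 = (h g^-1)(g h)] lie in the subgroup of equal determinants. Their trace
     signs, those of [b] and [a], multiply to -1, while [h^2] has the same trace under [R] and [S];
     hence that trace is 0. *)
  have := @tr_sign_mul _ _ R S hR hS two0 (h * g^-1)%g (g * h)%g.
  have ehh : (h * g^-1 * (g * h) = h * h)%g by rewrite mulgA mulgVK.
  rewrite ehh => sm.
  have thh : \tr (S (h * h)%g) = \tr (R (h * h)%g).
    by rewrite !tr_sqr // et.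
  have onhg : ~~ off (h * g^-1)%g by apply: off2 => //; apply: offV.
  have e : \tr (S (h * h)%g) * (\tr (R (h * g^-1)%g) * \tr (R (g * h)%g)) =
      \tr (R (h * h)%g) * (\tr (S (h * g^-1)%g) * \tr (S (g * h)%g)).
    apply: sm; first by apply/eqP/negPn.
    - by rewrite thh.
    - apply: on_tr; rewrite invgM mulgA; apply: off2; last exact: offV.
      by apply: on_off => //; apply: offV.
    - by rewrite !exprMn !on_tr.
  have {e} : \tr (R (h * h)%g) * (2 * (a * b)) = 0.
    have eb1 : b = \det (R h) * \det (R (g * h^-1)%g) * \tr (R (h * g^-1)%g).
      by rewrite /b -(ehg _ _ hR); ring.
    have eb2 : b' = \det (R h) * \det (R (g * h^-1)%g) * \tr (S (h * g^-1)%g).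
      by rewrite /b' -(ehg _ _ hS) eu; ring.
    have -> : 2 * (a * b) = a * b - a' * b' by rewrite ab'; ring.
    rewrite eb1 eb2 mulrBr; apply/eqP; rewrite subr_eq0; apply/eqP.
    transitivity (\det (R h) * \det (R (g * h^-1)%g) *
      (\tr (S (h * h)%g) * (\tr (R (h * g^-1)%g) * a))); first by rewrite thh; ring.
    by rewrite e; rewrite -/a'; ring.
  move/eqP; rewrite mulf_eq0 [2 * _ == 0]mulf_eq0 (negPf two0) (negPf ab0) /= orbF.
  by rewrite tr_sqr // subr_eq0 => /eqP.
have [v v0 hv] : common_line (fun A => exists2 x, off x & A = R x).
  apply: line_family_common; split.
  - by move=> _ [x _ ->]; exact: det_neq0.
  - move=> _ _ _ [x ox ->] [y oy ->] [z oz ->]; exists (x * y * z)%g; last by rewrite !homM.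
    by apply: on_off => //; apply: off2.
  (* The quadratic formula, with [\tr (S x)] as a square root of the discriminant. *)
  - move=> _ [x ox ->]; apply: (@eigenvec_of_root _ _ ((\tr (R x) + \tr (S x)) / 2)).
    have -> : \det (R x) = (\tr (R x) ^+ 2 - \tr (S x) ^+ 2) / 4.
      have four0 : 4 != 0 :> F by rewrite (_ : 4 = 2 * 2) ?mulf_neq0 //; ring.
      by rewrite off_tr //; field.
    have four0 : 4 != 0 :> F by rewrite (_ : 4 = 2 * 2) ?mulf_neq0 //; ring.
    by field; rewrite two0 four0.
  - move=> _ _ [g og ->] [h oh ->]; apply/eqP/negPn/negP => nc.
    have nc' : \det (R h *m R g - R g *m R h) != 0.
      by rewrite -opprB -scaleN1r detZ sqrrN expr1n mul1r.
    have th := bad _ _ og oh nc; have tg := bad _ _ oh og nc'.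
    have ogh : off (g * (h * h))%g by apply: off_on => //; apply: off2.
    (* The commutator of [h] with [g h^2] is that of [h] with [g], times [R(h^2)]. Thus [bad] also
       gives [t(g h^2)^2 = 2 d(g h^2)]; expanding this with [tr_merge] makes the original commutator
       determinant vanish. *)
    have nc2 : \det (R h *m R (g * (h * h))%g - R (g * (h * h))%g *m R h) != 0.
      have -> : R h *m R (g * (h * h))%g - R (g * (h * h))%g *m R h
          = (R h *m R g - R g *m R h) *m R (h * h)%g.
        by rewrite !homM // mulmxBl !mulmxA.
      by rewrite det_mulmx mulf_neq0 // det_neq0.
    have := bad h _ oh ogh nc2; rewrite tr_merge // mulgVK !det_homM // => e.
    case/negP: nc; rewrite det_comm // th tg.
    have e2 : (\tr (R h) * \tr (R (g * h)%g) - \det (R h) * \tr (R g)) ^+ 2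
       = \tr (R h) ^+ 2 * \tr (R (g * h)%g) ^+ 2 + \det (R h) ^+ 2 * \tr (R g) ^+ 2
         - 2 * \det (R h) * (\tr (R g) * \tr (R h) * \tr (R (g * h)%g)) by ring.
    rewrite {}e th tg in e2.
    set z := \tr (R g) * \tr (R h) * \tr (R (g * h)%g) in e2 *.
    have : 2 * \det (R h) * (z - \tr (R (g * h)%g) ^+ 2) = 0.
      by rewrite -[RHS](subrr (2 * (\det (R g) * (\det (R h) * \det (R h))))) {2}e2; ring.
    move/eqP; rewrite !mulf_eq0 (negPf two0) (negPf (det_neq0 hR h)) /= => /eqP e3.
    by rewrite -e3; apply/eqP; ring.
(* An element of the subgroup is [g0^-1] times [g0 x], with both [g0] and [g0 x] outside it, so the
   line is stable under it too. *)
exists v => // _ [x ->]; have [ox|nx] := boolP (off x); first by apply: hv; exists x.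
have [c0 e0] : eigenvec v (R g0) by apply: hv; exists g0.
have [c e] : eigenvec v (R (g0 * x)%g) by apply: hv; exists (g0 * x)%g => //; apply: off_on.
have e1 : v = c0 *: (R g0^-1%g *m v).
  by rewrite scalemxAr -e0 mulmxA -homM // mulVg hom1 // mul1mx.
have c00 : c0 != 0 by apply: contraNneq v0 => c00; rewrite e1 c00 scale0r.
exists (c / c0); rewrite -[x](mulKg g0) homM // -mulmxA e -scalemxAr {2}e1 scalerA divfK //.
Qed.

(** * Intertwiners from equal traces and determinants *)

Lemma kernel_line (A : 'M[F]_2) (v w : 'cV[F]_2) : A != 0 -> v != 0 -> A *m v = 0 -> A *m w = 0 ->
  exists c, w = c *: v.
Proof.
move=> A0 v0 ev ew; apply: cross_eq0 => //; apply/eqP/negPn/negP => nc.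
have uU : cols v w \in unitmx by rewrite cols_unit.
move/eqP: A0; apply; apply: (can_inj (mulmxK uU)).
by rewrite mul0mx mul_cols ev ew; apply/matrixP=> i j; rewrite !mxE if_same.
Qed.

Lemma mx_neq0_vec (A : 'M[F]_2) : A != 0 -> exists v : 'cV[F]_2, A *m v != 0.
Proof.
move=> A0; apply: contrapT => h; move/eqP: A0; apply; apply/matrixP => i j.
have /matrixP/(_ i 0) : A *m (\col_k (k == j)%:R) = 0.
  by apply/eqP/negPn/negP => hj; apply: h; exists (\col_k (k == j)%:R).
rewrite mul2E !mxE.
by move: j; apply: ord2_ind; rewrite /= !(mulr0, mulr1, addr0, add0r).
Qed.

Lemma cross_mul (A : 'M[F]_2) (v w : 'cV[F]_2) : cross (A *m v) (A *m w) = \det A * cross v w.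
Proof. by rewrite /cross det2E !mul2E; ring. Qed.

(* Pairs of values of one element of the group algebra of G. *)
Inductive pair_span R S : 'M[F]_2 -> 'M[F]_2 -> Prop :=
| PairGen x : pair_span R S (R x) (S x)
| PairAdd A A' B B' : pair_span R S A A' -> pair_span R S B B' ->
    pair_span R S (A + B) (A' + B')
| PairScale c A A' : pair_span R S A A' -> pair_span R S (c *: A) (c *: A').

Lemma pair_span_sym R S A A' : pair_span R S A A' -> pair_span S R A' A.
Proof. by elim=> *; constructor. Qed.

Section PairSpan.
Variables R S : G -> 'M[F]_2.
Hypotheses (hR : mx_hom R) (hS : mx_hom S).

Lemma pair_span_mul A A' B B' : pair_span R S A A' -> pair_span R S B B' ->
  pair_span R S (A *m B) (A' *m B').
Proof.
move=> hA hB; elim: hA => {A A'} [x|A1 A1' A2 A2' _ h1 _ h2|c A A' _ h].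
- elim: hB => {B B'} [y|B1 B1' B2 B2' _ h1 _ h2|c B B' _ h].
  + by rewrite -!homM //; apply: PairGen.
  + by rewrite !mulmxDr; apply: PairAdd.
  + by rewrite -!scalemxAr; apply: PairScale.
- by rewrite !mulmxDl; apply: PairAdd.
- by rewrite -!scalemxAl; apply: PairScale.
Qed.

Hypotheses (et : forall x, \tr (S x) = \tr (R x)) (ed : forall x, \det (S x) = \det (R x)).

Lemma pair_span_tr A A' : pair_span R S A A' -> \tr A' = \tr A.
Proof.
elim=> {A A'} [x|A1 A1' A2 A2' _ h1 _ h2|c A A' _ h] //.
- by rewrite !raddfD /= h1 h2.
- by rewrite !linearZ /= h.
Qed.

(** The determinant of a sum involves the trace of a product, which is controlled because pairs are
    closed under multiplication. *)
Lemma pair_span_det A A' : pair_span R S A A' -> \det A' = \det A.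
Proof.
elim=> {A A'} [x|A1 A1' A2 A2' l1 h1 l2 h2|c A A' _ h] //.
- by rewrite !det_add h1 h2 (pair_span_tr l1) (pair_span_tr l2)
    (pair_span_tr (pair_span_mul l1 l2)).
- by rewrite !detZ h.
Qed.

(* If A' <> 0 were the partner of 0, every A' S(x) would be nilpotent, and the
   image of A' would be an invariant line. *)
Lemma pair_span_inj A' : ~ reducible S -> pair_span R S 0 A' -> A' = 0.
Proof.
move=> irr h; apply: contrapT => /eqP A0; apply: irr.
have nil B : pair_span R S 0 B -> B *m B = 0.
  move=> hB; rewrite cayley_hamilton2 (pair_span_tr hB) (pair_span_det hB).
  by rewrite det0 linear0 scale0r raddf0 subrr.
have [v v0] := mx_neq0_vec A0; exists (A' *m v) => // _ [x ->].
have Av0 : A' *m (A' *m v) = 0 by rewrite mulmxA nil // mul0mx.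
apply: (kernel_line A0 v0 Av0).
(* Applying [(A' S(x))^2 = 0] to [S(x)^-1 v] shows that [S(x)] sends [A' v] into the kernel of [A'],
   which is the line of [A' v]. *)
have hx := pair_span_mul h (PairGen R S x); rewrite mul0mx in hx.
have := congr1 (mulmx^~ (S x^-1%g *m v)) (nil _ hx).
by rewrite /= mul0mx !mulmxA -(mulmxA _ (S x) (S _)) (homVr hS) mulmx1 -!mulmxA.
Qed.

End PairSpan.

(* The intertwiner is A u |-> A' u', where u and u' span the images of partners
   of rank one; if there are none, all nonzero A are invertible and any nonzero
   vectors will do. *)
Lemma irreducible_iso R S : mx_hom R -> mx_hom S -> ~ reducible R -> ~ reducible S ->
  (forall x, \tr (S x) = \tr (R x)) -> (forall x, \det (S x) = \det (R x)) ->
  exists2 P, P \in unitmx & forall x, P *m R x = S x *m P.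
Proof.
move=> hR hS iR iS et ed.
have inj A A' : pair_span R S A A' -> A = 0 -> A' = 0.
  by move=> h e; rewrite e in h; apply: (pair_span_inj hR hS).
have inj' A A' : pair_span R S A A' -> A' = 0 -> A = 0.
  move=> /pair_span_sym h e; rewrite e in h.
  exact: (pair_span_inj hS hR (fun x => esym (et x)) (fun x => esym (ed x))).
have [u [u' [u0 u0' huu]]] : exists u u' : 'cV[F]_2, [/\ u != 0, u' != 0 &
    forall A A', pair_span R S A A' -> A *m u = 0 -> A' *m u' = 0].
  have [[Z [Z' [hZ Z0 dZ]]]|no] := pselect (exists Z Z',
      [/\ pair_span R S Z Z', Z != 0 & \det Z = 0]).
    have Z0' : Z' != 0 by apply: contraNneq Z0 => e; rewrite (inj' _ _ hZ e).
    have [v v0] := mx_neq0_vec Z0; have [v' v0'] := mx_neq0_vec Z0'.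
    (* [Z v] spans the image of [Z], so [A Z v = 0] gives [A Z = 0], and then the partner [A' Z'] is
       0. *)
    exists (Z *m v), (Z' *m v'); split=> // A A' hA e.
    rewrite mulmxA (inj _ _ (pair_span_mul hR hS hA hZ)) ?mul0mx //.
    apply: contrapT => /eqP/mx_neq0_vec[y]; rewrite -mulmxA => /eqP; apply.
    have [|c ->] := @cross_eq0 _ (Z *m v) (Z *m y) v0; first by rewrite cross_mul dZ mul0r.
    by rewrite -scalemxAr e scaler0.
  exists (\col_i (i == 0)%:R), (\col_i (i == 0)%:R); split; try exact: e0_neq0.
  move=> A A' hA e; rewrite (inj _ _ hA) ?mul0mx //.
  apply: contrapT => /eqP A0; apply: no; exists A, A'; split=> //.
  have [w cw] := cross_basis (@e0_neq0 F).
  apply: (mulIf cw); rewrite mul0r -cross_mul e /cross !mxE; ring.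
(* By irreducibility [u] is not a common eigenvector, so some [R y u] completes it to a basis. *)
have [y cy] : exists y, cross u (R y *m u) != 0.
  apply: contrapT => no; apply: iR; exists u => // _ [x ->].
  apply: cross_eq0 => //; apply/eqP/negPn/negP => h; apply: no; by exists x.
have uU : cols u (R y *m u) \in unitmx by rewrite cols_unit.
have [P Pu Py] : exists2 P : 'M[F]_2, P *m u = u' & P *m (R y *m u) = S y *m u'.
  exists (cols u' (S y *m u') *m invmx (cols u (R y *m u)));
    have := mulmxKV uU (cols u' (S y *m u')); rewrite mul_cols => /matrixP e;
    apply/matrixP=> i j; rewrite (ord1 j).
  - by have := e i 0; rewrite !mxE.
  - by have := e i 1; rewrite !mxE.
have PR x : P *m (R x *m u) = S x *m u'.
  have [a [b e]] := cross_span (R x *m u) cy.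
  (* The group algebra element [x - a - b y] kills [u], so its partner kills [u']. *)
  have h := PairAdd (PairGen R S x) (PairAdd
     (PairScale (- a) (PairGen R S 1%g)) (PairScale (- b) (PairGen R S y))).
  have := huu _ _ h; rewrite !mulmxDl -!scalemxAl (hom1 hR) (hom1 hS) !mul1mx.
  rewrite {1}e !scaleNr -opprD subrr => /(_ erefl)/eqP; rewrite -opprD subr_eq0 => /eqP ->.
  by rewrite e mulmxDr -!scalemxAr Pu Py.
have inter x : P *m R x = S x *m P.
  apply: (can_inj (mulmxK uU)); rewrite !mul_cols -!mulmxA PR Pu Py.
  by rewrite [R x *m (R y *m u)]mulmxA -(homM hR) PR (homM hS) -mulmxA.
(* If [P] were singular, its kernel would be a line invariant under [R]. *)
exists P => //; rewrite unitmxE unitfE; apply/negP => /eqP dP; apply: iR.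
have P0 : P != 0 by apply: contraNneq u0' => e; rewrite -Pu e mul0mx.
have [v v0 Pv] := det0_vec dP; exists v => // _ [x ->].
by apply: (kernel_line P0 v0 Pv); rewrite mulmxA inter -mulmxA Pv mulmx0.
Qed.

Lemma group_two_cover (A B : G -> Prop) :
  (forall x y, A x -> A y -> A (x * y^-1)%g) -> (forall x y, B x -> B y -> B (x * y^-1)%g) ->
  (forall x, A x \/ B x) -> (forall x, A x) \/ (forall x, B x).
Proof.
move=> hA hB hAB.
have [|/existsNP[a na]] := pselect (forall x, A x); first by left.
have [|/existsNP[b nb]] := pselect (forall x, B x); first by right.
have Ba : B a by case: (hAB a).
have Ab : A b by case: (hAB b).
(* With [a] only in [B] and [b] only in [A], the quotient [a b^-1] can lie in neither. *)
case: (hAB (a * b^-1)%g) => h.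
- by case: na; have := hA _ _ h (hA _ _ (hA _ _ Ab Ab) Ab);
    rewrite mulgV mul1g invgK mulgVK.
- have B1 := hB _ _ Ba Ba; rewrite mulgV in B1.
  case: nb; have := hB _ _ (hB _ _ B1 h) (hB _ _ B1 Ba).
  by rewrite !mul1g invgM !invgK mulgVK.
Qed.

End Reducibility.

(** * Continuity *)

Section Continuity.
Variables (G : topGroupType) (E : topFieldType).
Implicit Types f g : G -> E.

Lemma continuous_addf f g : continuous f -> continuous g ->
  continuous (fun s => f s + g s).
Proof.
move=> hf hg s; apply: (@continuous2_cvg _ _ _ _ _ _ f g +%R); [|exact: hf|exact: hg].
exact: (add_continuous (f s, g s)).
Qed.

Lemma continuous_mulf f g : continuous f -> continuous g ->
  continuous (fun s => f s * g s).
Proof.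
move=> hf hg s; apply: (@continuous2_cvg _ _ _ _ _ _ f g *%R); [|exact: hf|exact: hg].
exact: (mulf_continuous (f s, g s)).
Qed.

Lemma continuous_invf f : (forall s, f s != 0) -> continuous f ->
  continuous (fun s => (f s)^-1).
Proof.
move=> f0 hf s; apply: (@continuous_comp _ _ _ f (fun y => y^-1)); first exact: hf.
exact: invf_continuous.
Qed.

Lemma continuous_coord m n (f : G -> 'M[E]_(m, n)) i j : continuous f ->
  continuous (fun s => f s i j).
Proof.
move=> hf s U nU; apply: (hf s (fun A => U (A i j))).
exists (fun i' j' => if (i' == i) && (j' == j) then U else setT).
  by move=> i' j'; case: ifP => [/andP[/eqP-> /eqP->]//|_]; exact: filterT.
by move=> A /(_ i j); rewrite !eqxx.
Qed.

Lemma continuous_mx m n (f : G -> 'M[E]_(m, n)) :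
  (forall i j, continuous (fun s => f s i j)) -> continuous f.
Proof.
move=> hf s U [P hP sub].
have : nbhs s (fun u => forall i j, P i j (f u i j)).
  apply: filter_forall => i; apply: filter_forall => j.
  exact: (hf i j s (P i j) (hP i j)).
by apply: filterS => u; apply: sub.
Qed.

Lemma continuous_sumf n (f : 'I_n -> G -> E) : (forall i, continuous (f i)) ->
  continuous (fun s => \sum_i f i s).
Proof.
elim: n f => [|n IH] f hf.
  rewrite (_ : (fun s => _) = fun=> 0); first by move=> s; exact: cst_continuous.
  by apply/funext => s; rewrite big_ord0.
rewrite (_ : (fun s => _) = fun s => f ord0 s + \sum_(i < n) f (lift ord0 i) s).
  by apply: continuous_addf => //; apply: IH.
by apply/funext => s; rewrite big_ord_recl.
Qed.

Lemma continuous_mulmx m n p (f : G -> 'M[E]_(m, n)) (g : G -> 'M[E]_(n, p)) :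
  continuous f -> continuous g -> continuous (fun s => f s *m g s).
Proof.
move=> hf hg; apply: continuous_mx => i j.
rewrite (_ : (fun s => _) = fun s => \sum_k f s i k * g s k j); last first.
  by apply/funext => s; rewrite mxE.
by apply: continuous_sumf => k; apply: continuous_mulf; apply: continuous_coord.
Qed.

Lemma continuous_translate (s : G) : continuous (fun u : G => (s * u)%g).
Proof.
move=> u; apply: (@continuous2_cvg _ _ _ _ _ _ (fun=> s) id (fun x y => (x * y)%g)).
- exact: (mulg_continuous (s, u)).
- exact: cst_continuous.
- exact: cvg_id.
Qed.

(* The closure of 0 is an ideal of the field E. *)
Lemma indiscrete_or_T1 : (forall (x : E) (U : set E), nbhs x U -> forall y, U y) \/
  (forall c : E, c != 0 -> exists2 U, nbhs (0 : E) U & ~ U c).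
Proof.
have [h|/existsNP[c /not_implyP[c0 nc]]] :=
  pselect (forall c : E, c != 0 -> exists2 U, nbhs (0 : E) U & ~ U c); first by right.
left=> x U nU y.
have hc V : nbhs (0 : E) V -> V c.
  by move=> nV; apply: contrapT => h; apply: nc; exists V.
(* An affine map taking 0 to [x] and [c] to [y]; since [c] lies in every neighbourhood of 0, [y]
   lies in every neighbourhood of [x]. *)
pose f z := x + z * ((y - x) / c).
have fc : {for 0, continuous f}.
  apply: (@continuous2_cvg _ _ _ _ _ _ (fun=> x) _ +%R).
  - exact: (add_continuous (x, 0 * ((y - x) / c))).
  - exact: cst_continuous.
  - apply: (@continuous2_cvg _ _ _ _ _ _ id (fun=> (y - x) / c) *%R).
    + exact: (mulf_continuous (0, (y - x) / c)).
    + exact: cvg_id.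
    + exact: cst_continuous.
have : nbhs (f 0) U by rewrite /f mul0r addr0.
by move/fc/hc; rewrite /preimage /= /f mulrC divfK // addrC subrK.
Qed.

(** If [E] is indiscrete every map to it is continuous. Otherwise [f] is nonzero near 1, so [chi] is
    1 there and, by translation, locally constant. *)
Lemma continuous_sign_char (chi f : G -> E) :
  (forall s u, chi (s * u)%g = chi s * chi u) ->
  continuous f -> f 1%g != 0 -> (forall s, f s != 0 -> chi s = 1) ->
  continuous chi.
Proof.
move=> chiM hf f1 hchi s U nU.
have [ind|t1] := indiscrete_or_T1.
  have : nbhs s [set: G] by exact: filterT.
  by apply: filterS => u _; apply: (ind _ _ nU).
have [V nV Vf] := t1 _ f1.
have n1 : nbhs (1%g : G) (fun u => f u != 0).
  pose h u := f 1%g + (-1) * f u.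
  have hc : continuous h.
    by apply: continuous_addf; [|apply: continuous_mulf => //]; move=> x; exact: cst_continuous.
  have nV1 : nbhs (h 1%g) V by rewrite /h mulN1r subrr.
  apply: (@filterS _ (nbhs (1%g : G)) _ (h @^-1` V)); last exact: hc.
  move=> u; rewrite /preimage /= => hu; apply/eqP => fu.
  by apply: Vf; rewrite /h fu mulr0 addr0 in hu.
have : nbhs s (fun u => f (s^-1 * u)%g != 0).
  have n1s : nbhs (s^-1 * s)%g (fun u => f u != 0) by rewrite mulVg.
  exact: (continuous_translate n1s).
apply: filterS => u fu; rewrite /preimage /=.
rewrite (_ : chi u = chi s); first exact: nbhs_singleton.
by rewrite -[u in LHS](mulVKg s) chiM (hchi _ fu) mulr1.
Qed.

End Continuity.

(** * Representations of degree two *)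

Section Representations.
Variables (G : topGroupType) (E : topFieldType).
Implicit Types (rho : contRepr G E 2).

Lemma contRepr_hom rho : mx_hom rho.
Proof. by split; [exact: repr_mx1|exact: repr_mxM]. Qed.

Lemma rev_char_poly2 (A : 'M[E]_2) :
  rev_char_poly A = 1 - (\tr A)%:P * 'X + (\det A)%:P * 'X ^+ 2.
Proof.
rewrite /rev_char_poly det2E !mxE /= tr2E det2E !(polyCD, polyCN, polyCM).
rewrite /=; ring.
Qed.

Lemma rev_char_poly2_inj (A B : 'M[E]_2) : rev_char_poly A = rev_char_poly B ->
  \tr A = \tr B /\ \det A = \det B.
Proof.
rewrite !rev_char_poly2 => /polyP e; split.
- have := e 1%N; rewrite !(coefD, coefN, coefCM, coefX, coefXn, coef1) /=.
  by rewrite !(mulr1, mulr0, addr0, sub0r) => /oppr_inj.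
- have := e 2%N; rewrite !(coefD, coefN, coefCM, coefX, coefXn, coef1) /=.
  by rewrite !(mulr1, mulr0, oppr0, add0r, subr0).
Qed.

Lemma vspace_line (U : {vspace 'cV[E]_2}) : U != 0%VS -> (\dim U < 2)%N ->
  U = <[vpick U]>%VS.
Proof.
move=> U0 dU; apply/eqP; rewrite eq_sym eqEdim -memvE memv_pick /= dim_vline vpick0 U0 /=.
by [].
Qed.

(** The invariant line excludes a two-dimensional irreducible summand, so all summands are lines;
    two distinct ones give a basis of eigenvectors. *)
Lemma semisimple_diagonalized rho : semisimple rho -> reducible rho ->
  exists P l m, diagonalized rho P l m.
Proof.
move=> [t [U [irr _ full]]] [v v0 hv].
have dfull : \dim (fullv : {vspace 'cV[E]_2}) = 2 by rewrite dimvf dim_matrix.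
have dU i : (\dim (U i) < 2)%N.
  rewrite ltnNge; apply/negP => d2; have [_ _ hi] := irr i.
  have eU : U i = fullv by apply/eqP; rewrite eqEdim subvf dfull.
  have [||/eqP|/(congr1 (fun W => \dim W))] := hi <[v]>%VS.
  - move=> s w /vlineP[k ->]; have [|c e] := hv (rho s); first by exists s.
    by rewrite -scalemxAr e !memvZ // memv_line.
  - by rewrite eU subvf.
  - by rewrite -vpick0 -[_ == 0]negbK vpick0 -dimv_eq0 dim_vline v0.
  - by rewrite dim_vline v0 eU dfull.
have U0 i : U i != 0%VS by have [] := irr i.
have lineU i := vspace_line (U0 i) (dU i).
have [i0 _] : exists i0 : 'I_t, True.
  case: t U irr full {dU U0 lineU} => [|t] U irr full; last by exists ord0.
  by move: dfull; rewrite -full big_ord0 dimv0.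
have [j nj] : exists j, ~~ (U j <= U i0)%VS.
  apply: contrapT => no; suff : (fullv <= U i0)%VS.
    by move/dimvS; rewrite dfull leqNgt dU.
  by rewrite -full; apply/subv_sumP => j _; apply/negPn/negP => nj; apply: no; exists j.
have eig i s : eigenvec (vpick (U i)) (rho s).
  have [inv _ _] := irr i; have := inv s _ (memv_pick (U i)).
  by rewrite {2}(lineU i) => /vlineP[c e]; exists c.
have nc : cross (vpick (U i0)) (vpick (U j)) != 0.
  apply/negP => /eqP /cross_eq0[|c e]; first by rewrite vpick0.
  by case/negP: nj; rewrite (lineU j) -memvE e memvZ // memv_pick.
have [l hl] := choice (eig i0); have [m hm] := choice (eig j).
exists (cols (vpick (U i0)) (vpick (U j))), l, m; split; first by rewrite cols_unit.
by move=> s; rewrite mul_cols cols_diag hl hm.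
Qed.

(** [p i] and [q i] are the inclusion of and projection to the i-th summand; stacked into a block
    row and a block column they are mutually inverse. *)
Lemma isomorphic_direct_sum n t (k : 'I_t -> nat) (rho : G -> 'M[E]_n)
    (rho_ : forall i, contRepr G E (k i))
    (p : forall i, 'M[E]_(n, k i)) (q : forall i, 'M[E]_(k i, n)) :
  \sum_i p i *m q i = 1%:M -> (forall i, q i *m p i = 1%:M) ->
  (forall i j, i != j -> q i *m p j = 0) ->
  (forall i s, rho s *m p i = p i *m rho_ i s) ->
  isomorphic rho (direct_sum rho_).
Proof.
move=> pq qp qp0 inter; exists (\mxrow_i p i), (\mxcol_i q i); split.
- by rewrite mul_mxrow_mxcol.
- rewrite mul_mxcol_mxrow -mxdiagZ; apply: eq_mxblock => i j.
  by case: eqP => [e|/eqP/qp0//]; subst j; rewrite conform_mx_id qp.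
- by move=> s; rewrite mul_mxrow mul_mxrow_mxdiag; apply: eq_mxrow => i; rewrite inter.
Qed.

Section CharacterRepr.
Variables (l : G -> E).
Hypotheses (l1 : l 1%g = 1) (lM : forall s u, l (s * u)%g = l s * l u) (lc : continuous l).

Fact char_repr_mxM s u : (l (s * u)%g)%:M = (l s)%:M *m (l u)%:M :> 'M[E]_1.
Proof. by rewrite lM -scalar_mxM. Qed.

Fact char_repr_continuous : continuous (fun s => (l s)%:M : 'M[E]_1).
Proof.
apply: continuous_mx => i j; rewrite (_ : (fun s => _) = l) //.
by apply/funext => s; rewrite !ord1 mxE.
Qed.

Definition char_repr : contRepr G E 1 :=
  @ContRepr G E 1 (fun s => (l s)%:M) (congr1 scalar_mx l1) char_repr_mxM
    char_repr_continuous.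

End CharacterRepr.

Lemma diagonalized_swap (R : G -> 'M[E]_2) P l m : diagonalized R P l m ->
  exists P', diagonalized R P' m l.
Proof.
move=> [uP h]; pose J : 'M[E]_2 := \matrix_(i, j) (i != j)%:R.
have uJ : J \in unitmx.
  by rewrite unitmxE det2E !mxE /= unitfE mul0r sub0r mulr1 oppr_eq0 oner_eq0.
exists (P *m J); split; first by rewrite unitmx_mul uP.
move=> s; rewrite mulmxA h -!mulmxA; congr (_ *m _).
by apply: mx2P; apply: ord2_ind; rewrite !mul2E !mxE /=; ring.
Qed.

Lemma diagonalized_continuous rho P l m : diagonalized rho P l m ->
  continuous l /\ continuous m.
Proof.
move=> h; have [uP _] := h; have e s : diag2 (l s) (m s) = invmx P *m rho s *m P.
  by rewrite (diagonalizedE h) !mulmxA mulVmx // mul1mx mulmxKV.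
have c : continuous (fun s => diag2 (l s) (m s)).
  rewrite (_ : (fun s => _) = fun s => invmx P *m rho s *m P); last exact/funext.
  apply: continuous_mulmx; last by move=> s; exact: cst_continuous.
  apply: continuous_mulmx; last exact: repr_mx_continuous.
  by move=> s; exact: cst_continuous.
split.
- have := continuous_coord (i := 0) (j := 0) c.
  by rewrite (_ : (fun s => _) = l) //; apply/funext => s; rewrite mxE.
- have := continuous_coord (i := 1) (j := 1) c.
  by rewrite (_ : (fun s => _) = m) //; apply/funext => s; rewrite mxE.
Qed.

End Representations.

(** * Twists *)

Section Twists.
Variables (G : topGroupType) (E : topFieldType).
Implicit Types (rho : contRepr G E 2).

Lemma diagonalized_hom1 (R : G -> 'M[E]_2) P l m : mx_hom R -> diagonalized R P l m ->
  [/\ l 1%g = 1, m 1%g = 1, forall s, l s != 0 & forall s, m s != 0].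
Proof.
move=> hR h; have [lM mM] := diagonalized_hom hR h.
have lm0 s : (l s != 0) && (m s != 0).
  by rewrite -negb_or -mulf_eq0 -(diagonalized_det h) det_neq0.
have l0 s : l s != 0 by case/andP: (lm0 s).
have m0 s : m s != 0 by case/andP: (lm0 s).
split=> //; [apply: (mulfI (l0 1%g))|apply: (mulfI (m0 1%g))];
  by rewrite mulr1 -?lM -?mM mulg1.
Qed.

Lemma col_mulmx m n p (A : 'M[E]_(m, n)) (B : 'M[E]_(n, p)) j :
  col j (A *m B) = A *m col j B.
Proof. by apply/colP => i; rewrite !mxE; apply: eq_bigr => k _; rewrite mxE. Qed.

Lemma isomorphic_diagonalized rho P l m
    (l1 : l 1%g = 1) (lM : forall s u, l (s * u)%g = l s * l u) (lc : continuous l)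
    (m1 : m 1%g = 1) (mM : forall s u, m (s * u)%g = m s * m u) (mc : continuous m) :
  diagonalized rho P l m ->
  isomorphic rho (direct_sum (fun i : 'I_2 =>
    if i == 0 then char_repr l1 lM lc else char_repr m1 mM mc)).
Proof.
move=> [uP h].
apply: (isomorphic_direct_sum (p := fun i => col i P) (q := fun i => row i (invmx P))).
- rewrite -(mulmxV uP) !big_ord_recl big_ord0 lift00 addr0; apply/matrixP => i j.
  by rewrite [RHS]mul2E !mxE !big_ord1 !mxE.
- move=> i; rewrite -col_mulmx -row_mul mulVmx //.
  by apply/matrixP => a b; rewrite !mxE !ord1 eqxx.
- move=> i j ij; rewrite -col_mulmx -row_mul mulVmx //.
  by apply/matrixP => a b; rewrite !mxE (negPf ij).
- move=> i s; rewrite -col_mulmx h; apply/colP => k; rewrite [LHS]mxE mul2E [RHS]mxE big_ord1.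
  by move: i; apply: ord2_ind; rewrite !mxE /=; ring.
Qed.

(** Left transparent because the values [m s / l s] are computed with later. *)
Definition ratio_char (l m : G -> E) (l0 : forall s, l s != 0)
    (lM : forall s u, l (s * u)%g = l s * l u) (lc : continuous l)
    (mM : forall s u, m (s * u)%g = m s * m u) (mc : continuous m)
    (e : forall s, m s ^+ 2 = l s ^+ 2) : quadChar G E.
Proof.
apply: (@QuadChar G E (fun s => m s / l s)).
- by move=> s u; rewrite lM mM invfM mulrACA.
- move=> s; have /eqP := e s; rewrite eqf_sqr => /orP[] /eqP ->; [left|right].
  + by rewrite divff.
  + by rewrite mulNr divff.
- by apply: continuous_mulf => //; apply: continuous_invf.
Defined.

Lemma sqr_ratio_closed (l m : G -> E) : (forall s, l s != 0) ->
  (forall s u, l (s * u)%g = l s * l u) -> (forall s u, m (s * u)%g = m s * m u) ->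
  forall s u, m s ^+ 2 = l s ^+ 2 -> m u ^+ 2 = l u ^+ 2 ->
    m (s * u^-1)%g ^+ 2 = l (s * u^-1)%g ^+ 2.
Proof.
move=> l0 lM mM s u es eu.
have lu : l u ^+ 2 != 0 by rewrite expf_neq0.
by apply: (mulIf lu); rewrite -{1}eu -!exprMn -mM -lM mulgVK.
Qed.

Lemma diagonalized_twists_aligned rho rho' P P' l m l' m' :
  diagonalized rho P l m -> diagonalized rho' P' l' m' ->
  (forall s, l' s ^+ 2 = l s ^+ 2) -> (forall s, m' s ^+ 2 = m s ^+ 2) ->
  polyquadratic_twists rho rho'.
Proof.
move=> h h' el em.
have hR := contRepr_hom rho; have hS := contRepr_hom rho'.
have [lM mM] := diagonalized_hom hR h; have [lM' mM'] := diagonalized_hom hS h'.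
have [lc mc] := diagonalized_continuous h; have [lc' mc'] := diagonalized_continuous h'.
have [l1 m1 l0 m0] := diagonalized_hom1 hR h; have [l1' m1' l0' m0'] := diagonalized_hom1 hS h'.
exists 2%N, (fun=> 1%N),
  (fun i => if i == 0 then char_repr l1 lM lc else char_repr m1 mM mc),
  (fun i => if i == 0 then char_repr l1' lM' lc' else char_repr m1' mM' mc'),
  (fun i => if i == 0 then ratio_char l0 lM lc lM' lc' el
            else ratio_char m0 mM mc mM' mc' em).
split=> //.
- exact: (isomorphic_diagonalized l1 lM lc m1 mM mc h).
- exact: (isomorphic_diagonalized l1' lM' lc' m1' mM' mc' h').
move=> i; exists 1%:M, 1%:M; split; rewrite ?mulmx1 // => s.
rewrite mulmx1 mul1mx /twist; case: ifP => _ /=; rewrite scale_scalar_mx divfK //.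
Qed.

Lemma diagonalized_twists rho rho' P P' l m l' m' :
  diagonalized rho P l m -> diagonalized rho' P' l' m' ->
  (forall s, \tr (rho' (s * s)%g) = \tr (rho (s * s)%g)) ->
  (forall s, \det (rho' (s * s)%g) = \det (rho (s * s)%g)) ->
  polyquadratic_twists rho rho'.
Proof.
move=> h h' et ed.
have hR := contRepr_hom rho; have hS := contRepr_hom rho'.
have [lM mM] := diagonalized_hom hR h; have [lM' mM'] := diagonalized_hom hS h'.
have [l1 m1 l0 m0] := diagonalized_hom1 hR h.
have [] := @group_two_cover G (fun s => l' s ^+ 2 = l s ^+ 2 /\ m' s ^+ 2 = m s ^+ 2)
  (fun s => l' s ^+ 2 = m s ^+ 2 /\ m' s ^+ 2 = l s ^+ 2).
- by move=> s u [? ?] [? ?]; split; apply: sqr_ratio_closed.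
- by move=> s u [? ?] [? ?]; split; apply: sqr_ratio_closed.
- move=> s; have := et s; have := ed s.
  rewrite !(diagonalized_tr h, diagonalized_tr h', diagonalized_det h, diagonalized_det h').
  rewrite !(lM, mM, lM', mM') -!expr2.
  set a := l s ^+ 2; set b := m s ^+ 2; set c := l' s ^+ 2; set d := m' s ^+ 2 => e1 e2.
  (* The pairs [a, b] and [c, d] have equal sums and products, so [c] is a root of
     [(X - a)(X - b)]. *)
  have : (c - a) * (c - b) = 0.
    have -> : (c - a) * (c - b) = c ^+ 2 - (a + b) * c + a * b by ring.
    by rewrite -e1 -e2; ring.
  move/eqP; rewrite mulf_eq0 !subr_eq0 => /orP[] /eqP e; rewrite e in e2 *;
    [left|right]; split=> //.
  + exact: (addrI a e2).
  + by apply: (addrI b); rewrite e2 addrC.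
- move=> hA; apply: (diagonalized_twists_aligned h h') => s; by case: (hA s).
(* A crosswise matching becomes aligned after exchanging the two basis vectors for [rho']. *)
- move=> hB; have [P'' h''] := diagonalized_swap h'.
  by apply: (diagonalized_twists_aligned h h'') => s; case: (hB s).
Qed.

Lemma isomorphic_twist rho rho' (chi : quadChar G E) :
  isomorphic rho' (twist chi rho) -> polyquadratic_twists rho rho'.
Proof.
move=> h; exists 1%N, (fun=> 2%N), (fun=> rho), (fun=> rho'), (fun=> chi).
have iso (r : contRepr G E 2) : isomorphic r (direct_sum (fun _ : 'I_1 => r)).
  apply: (isomorphic_direct_sum (p := fun=> 1%:M) (q := fun=> 1%:M)).
  - by rewrite big_ord1 mulmx1.
  - by move=> i; rewrite mulmx1.
  - by move=> i j; rewrite !ord1.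
  - by move=> i s; rewrite mulmx1 mul1mx.
by split.
Qed.

Lemma twist_hom rho (chi : quadChar G E) : mx_hom (twist chi rho).
Proof.
have chi1 : chi 1%g = 1.
  have c0 : chi 1%g != 0 by case: (qchar_pm1 chi 1%g) => ->; rewrite ?oppr_eq0 oner_eq0.
  by apply: (mulfI c0); rewrite mulr1 -qcharM mulg1.
split=> [|s u]; rewrite /twist; first by rewrite chi1 repr_mx1 scale1r.
by rewrite qcharM repr_mxM -scalemxAr -scalemxAl scalerA mulrC.
Qed.

Lemma twist_reducible rho (chi : quadChar G E) : reducible (twist chi rho) -> reducible rho.
Proof.
move=> [v v0 h]; exists v => // _ [s ->].
have [|c] := h (twist chi rho s); first by exists s.
rewrite /twist -scalemxAl; case: (qchar_pm1 chi s) => ->.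
- by rewrite scale1r => e; exists c.
- by rewrite scaleN1r => e; exists (- c); rewrite scaleNr -e opprK.
Qed.

Lemma trivial_char_subproof : continuous (fun _ : G => 1 : E).
Proof. by move=> s; exact: cst_continuous. Qed.

Definition trivial_char : quadChar G E :=
  @QuadChar G E (fun=> 1) (fun _ _ => esym (mulr1 1)) (fun=> or_introl erefl)
    trivial_char_subproof.

Lemma exists_sign_char rho rho' :
  ~ (reducible rho /\ reducible rho') ->
  (forall s, \tr (rho' (s * s)%g) = \tr (rho (s * s)%g)) ->
  (forall s, \det (rho' (s * s)%g) = \det (rho (s * s)%g)) ->
  exists chi : quadChar G E, (forall s, \tr (rho' s) = chi s * \tr (rho s)) /\
    (forall s, \det (rho' s) = \det (rho s)).
Proof.
move=> irr et2 ed2; have hR := contRepr_hom rho; have hS := contRepr_hom rho'.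
have et s : \tr (rho' s) ^+ 2 - 2 * \det (rho' s) = \tr (rho s) ^+ 2 - 2 * \det (rho s).
  by rewrite -!tr_sqr.
have ed s : \det (rho' s) = \det (rho s) \/ \det (rho' s) = - \det (rho s).
  have /eqP := ed2 s; rewrite !det_homM // -!expr2 eqf_sqr.
  by case/orP => /eqP; [left|right].
(* In characteristic 2 signs disappear and squaring is injective, so traces and determinants agree
   outright. *)
have [two0|two0] := eqVneq (2 : E) 0.
  have opp (x : E) : - x = x.
    by apply/eqP; rewrite -subr_eq0 -opprD -mulr2n -mulr_natl two0 mul0r oppr0.
  exists trivial_char; split=> s.
  - rewrite mul1r; have /eqP := et s; rewrite two0 !mul0r !subr0 eqf_sqr opp.
    by rewrite orbb => /eqP.
  - by case: (ed s) => ->; rewrite ?opp.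
have eqd s : \det (rho' s) = \det (rho s).
  apply/eqP/negPn/negP => ne; apply: irr; split.
  - by apply: (index2_reducible hR hS two0 ed et); exists s.
  - apply: (index2_reducible hS hR two0 _ (fun x => esym (et x))).
    + by move=> x; case: (ed x) => ->; [left|right; rewrite opprK].
    + by exists s; rewrite eq_sym.
have eqt s : \tr (rho' s) ^+ 2 = \tr (rho s) ^+ 2.
  by have := et s; rewrite eqd => /addIr.
have [chi [chiM chipm chit chi1]] := tr_sign_char hR hS two0 eqd eqt.
have trc (r : contRepr G E 2) : continuous (fun s => \tr (r s)).
  rewrite (_ : (fun s => _) = fun s => r s 0 0 + r s 1 1); last first.
    by apply/funext => s; rewrite tr2E.
  by apply: continuous_addf; apply: continuous_coord; exact: repr_mx_continuous.
have chic : continuous chi.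
  (* The sum of the traces is 4 at the identity; where it is nonzero, the traces are equal and
     nonzero, so [chi] is 1. *)
  apply: (continuous_sign_char chiM (continuous_addf (trc rho) (trc rho'))).
  - rewrite (tr_hom1 hR) (tr_hom1 hS) (_ : 2 + 2 = 2 * 2); first by rewrite mulf_neq0.
    by ring.
  - move=> s nz; have /eqP := eqt s; rewrite eqf_sqr => /orP[] /eqP e.
    + apply: chi1 => //; apply: contraNneq nz => e0; by rewrite e e0 addr0.
    + by move: nz; rewrite e subrr eqxx.
by exists (QuadChar chiM chipm chic).
Qed.

End Twists.

(** * The split into a pair of diagonal representations and a single irreducible twist *)

Theorem theorem2p11 (E : topFieldType) (G : topGroupType)
    (compactG : compact [set: G]) (rho rho' : contRepr G E 2)
    (ss : semisimple rho) (ss' : semisimple rho') :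
  locally_polyquadratic_twists rho rho' -> polyquadratic_twists rho rho'.
Proof.
move=> loc; have hR := contRepr_hom rho; have hS := contRepr_hom rho'.
have loc2 s := rev_char_poly2_inj (loc s).
have et s : \tr (rho' (s * s)%g) = \tr (rho (s * s)%g) by rewrite -expg2; case: (loc2 s).
have ed s : \det (rho' (s * s)%g) = \det (rho (s * s)%g) by rewrite -expg2; case: (loc2 s).
have [[/(semisimple_diagonalized ss)[P [l [m h]]] /(semisimple_diagonalized ss')[P' [l' [m' h']]]]
  |irr] := pselect (reducible rho /\ reducible rho').
  exact: (diagonalized_twists h h').
have [chi [tchi dchi]] := exists_sign_char irr et ed.
apply: (isomorphic_twist (chi := chi)).
have hT := twist_hom rho chi.
have chi2 s : chi s ^+ 2 = 1 by case: (qchar_pm1 chi s) => ->; rewrite ?sqrrN expr1n.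
have tT s : \tr (rho' s) = \tr (twist chi rho s) by rewrite tchi /twist mxtraceZ.
have dT s : \det (rho' s) = \det (twist chi rho s) by rewrite dchi /twist detZ chi2 mul1r.
(* If [rho] were reducible, semisimplicity would diagonalise it and hence its twist; [rho'], having
   the same traces and determinants as the twist, would then be reducible too. *)
have iR : ~ reducible rho.
  move=> r; apply: irr; split=> //; have [P [l [m [uP h]]]] := semisimple_diagonalized ss r.
  have hP : diagonalized (twist chi rho) P (fun s => chi s * l s) (fun s => chi s * m s).
    split=> // s; rewrite /twist -scalemxAl h scalemxAr; congr (_ *m _).
    by apply/matrixP=> i j; rewrite !mxE; case: ifP => _; [case: ifP|rewrite mulr0].
  exact: (diagonalized_reducible hT hS hP).
have iS : ~ reducible rho'.
  move=> r; have [P [l [m h]]] := semisimple_diagonalized ss' r; apply: iR.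
  apply: (@twist_reducible _ _ rho chi).
  exact: (diagonalized_reducible hS hT h (fun s => esym (tT s)) (fun s => esym (dT s))).
have iT : ~ reducible (twist chi rho) by move/twist_reducible.
have [P uP hP] := irreducible_iso hS hT iS iT (fun s => esym (tT s)) (fun s => esym (dT s)).
exists (invmx P), P; split; rewrite ?mulVmx ?mulmxV // => s.
by apply: (can_inj (mulKmx uP)); rewrite mulKVmx // !mulmxA hP mulmxK.
Qed.
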